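(* If $X_1,X_2$ are i.i.d. real-valued continuous random variables, then $$\frac12\leq\frac{h(X_1+X_2)-h(X_1)}{h(X_1-X_2)-h(X_1)}\leq 2,$$ equivalently $$\frac12\leq\frac{I(X_1+X_2;X_2)}{I(X_1-X_2;X_2)}\leq 2.$$ (In non-ratio form: $h(X_1+X_2)-h(X_1)\le 2[h(X_1-X_2)-h(X_1)]$ and $h(X_1-X_2)-h(X_1)\le 2[h(X_1+X_2)-h(X_1)]$.)
   Context: Standing conventions: all random variables are real-valued with densities (random vectors have joint densities), and every differential entropy appearing is assumed to exist and be finite. $h$ denotes differential entropy and $I(U;V)=h(U)+h(V)-h(U,V)$ mutual information. *)

(* Defs.v *)
From HB Require Import structures.
From mathcomp Require Import all_boot all_order all_algebra.
From mathcomp Require Import all_classical all_reals all_analysis.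
Set Implicit Arguments. Unset Strict Implicit. Unset Printing Implicit Defensive.
Import Order.TTheory GRing.Theory Num.Theory.
Local Open Scope classical_set_scope.
Local Open Scope ring_scope.

Definition is_density d (T : measurableType d) (R : realType)
  (P : probability T R) (X : T -> R) (f : R -> R) : Prop :=
  measurable_fun setT f /\ (forall x, 0 <= f x) /\
  forall A : set R, measurable A ->
    P (X @^-1` A) = (\int[@lebesgue_measure R]_(x in A) (f x)%:E)%E.

Definition entropy_finite (R : realType) (f : R -> R) : Prop :=
  (@lebesgue_measure R).-integrable setT (fun x => (f x * ln (f x))%:E).

(* differential entropy h = - \int f ln f  (with 0 ln 0 = 0) *)
Definition diff_entropy (R : realType) (f : R -> R) : R :=
  - Rintegral (@lebesgue_measure R) setT (fun x => f x * ln (f x)).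

Definition indep2 d (T : measurableType d) (R : realType)
  (P : probability T R) (X Y : T -> R) : Prop :=
  forall A B : set R, measurable A -> measurable B ->
    P (X @^-1` A `&` Y @^-1` B) = (P (X @^-1` A) * P (Y @^-1` B))%E.

Definition ident_distr d (T : measurableType d) (R : realType)
  (P : probability T R) (X Y : T -> R) : Prop :=
  forall A : set R, measurable A -> P (X @^-1` A) = P (Y @^-1` A).

(* Main.v *)
Require Import Defs.
From HB Require Import structures.
From mathcomp Require Import all_boot all_order all_algebra.
From mathcomp Require Import all_classical all_reals all_analysis.
From mathcomp Require Import measurable_realfun.
Import Order.TTheory GRing.Theory Num.Theory.
Local Open Scope classical_set_scope.
Local Open Scope ring_scope.
Set Implicit Arguments.
Unset Strict Implicit.

(** Write [h] for the entropy of [X1] and let [U, V, W] be three independent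
    copies of [X1]; [p] and [m] are the densities of [X1 + X2] and [X1 - X2].
    Both inequalities come from [ln x <= x - 1] applied to an explicit ratio of
    densities whose mean is at most [1].

    - [h(X1 - X2) + h <= 2 h(X1 + X2)] is [E ln Z <= 0] for
      [Z = p(U + W) p(V + W) / (m(U - V) f(W))]. Integrating out [W], where
      [f(W)] cancels, leaves a function of [U - V], and then [m] cancels.
    - [h(X1 + X2) + h <= 2 h(X1 - X2)] goes through [h(U + V - W)], which need
      not be finite. With [rho] the density of [U + V - W], the ratios
      [a = m(U - W) m(V - W) / (rho(U + V - W) f(W))] (submodularity) and
      [b = rho(U + V - W) / p(U + V)] (adding noise increases entropy) both have
      mean at most [1], while [rho] disappears from
      [a b = m(U - W) m(V - W) / (p(U + V) f(W))], so only finite entropies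
      occur in [E ln (a b)]. *)

(* [distribution] requires a bundled measurable function. *)
Definition law (d d' : measure_display) (Y : measurableType d)
    (Z : measurableType d') (R : realType) (Q : probability Y R)
    (U : Y -> Z) (mU : measurable_fun setT U) : probability Z R :=
  distribution Q (HB.pack_for {mfun Y >-> Z} U (isMeasurableFun.Build _ _ _ _ _ mU)).

(** * Invariance of Lebesgue integrals under translation and reflection *)

Section lebesgue_invariance.
Local Open Scope ereal_scope.
Context {R : realType}.
(* [lebesgue_measure] lives on [measurableTypeR R], whose measurable structure is
   convertible, but not syntactically equal, to the canonical one of [R]. *)
Local Notation RM := (measurableTypeR R).
Local Notation lambda := (@lebesgue_measure R).

(** By uniqueness of Lebesgue measure, it suffices to compare both sides on half-open intervals. *)
Lemma lebesgue_measure_shift (c : R) (A : set R) : measurable A ->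
  pushforward lambda (fun x : RM => (x + c)%R : RM) A = lambda A.
Proof.
move=> mA.
have mc : measurable_fun setT (fun x : RM => (x + c)%R : RM).
  exact: (@measurable_funD _ RM R setT id (cst c)).
pose nu : {measure set RM -> \bar R} :=
  measure_function_pushforward__canonical__measure_function_Measure lambda mc.
suff : lambda A = nu A by [].
apply: (@lebesgue_measure_unique R nu) => //= _ [[a b]] _ <-.
rewrite /nu /pushforward/=.
have -> : (fun x : R => x + c)%R @^-1` `]a, b] = `](a - c)%R, (b - c)%R]%classic.
  by apply/seteqP; split => x /=; rewrite !in_itv/= ltrBlDr lerBrDr.
rewrite !lebesgue_measure_itv/= !lte_fin ltrD2r; case: ifPn => // _.
by rewrite -!EFinB opprB addrA subrK.
Qed.

Lemma ge0_integral_shift (c : R) (h : R -> \bar R) : measurable_fun setT h ->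
  (forall x, 0 <= h x) -> \int[lambda]_x h (x + c)%R = \int[lambda]_x h x.
Proof.
move=> mh h0.
have mc : measurable_fun setT (fun x : RM => (x + c)%R : RM).
  exact: (@measurable_funD _ RM R setT id (cst c)).
have := @ge0_integral_pushforward _ _ RM RM R (fun x : RM => (x + c)%R : RM) mc
  lambda setT h measurableT mh (fun y _ => h0 y).
rewrite preimage_setT => /esym ->.
by apply: eq_measure_integral => //= A mA _; exact: lebesgue_measure_shift.
Qed.

Lemma ge0_integral_opp (h : R -> \bar R) : measurable_fun setT h ->
  (forall x, 0 <= h x) -> \int[lambda]_x h (- x)%R = \int[lambda]_x h x.
Proof.
move=> mh h0.
have mc : measurable_fun setT (fun x : RM => (- x)%R : RM).
  exact: (@measurableT_comp _ _ _ RM R R (-%R)).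
have := @ge0_integral_pushforward _ _ RM RM R (fun x : RM => (- x)%R : RM) mc
  lambda setT h measurableT mh (fun y _ => h0 y).
rewrite preimage_setT => /esym ->.
by apply: eq_measure_integral => //= A mA _; exact: lebesgue_measureN.
Qed.

Lemma ge0_integral_reflect (c : R) (h : R -> \bar R) : measurable_fun setT h ->
  (forall x, 0 <= h x) -> \int[lambda]_x h (c - x)%R = \int[lambda]_x h x.
Proof.
move=> mh h0; rewrite -[RHS](ge0_integral_shift c)//.
rewrite -[RHS]ge0_integral_opp//; first by under [RHS]eq_integral do rewrite addrC.
apply: measurableT_comp mh _.
exact: (@measurable_funD _ RM R setT id (cst c)).
Qed.

End lebesgue_invariance.

(** * Expectations of functions of a variable with a density *)

Section density.
Local Open Scope ereal_scope.
Context (d : measure_display) (Y : measurableType d) (R : realType).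
Context (Q : probability Y R).
Local Notation RM := (measurableTypeR R).
Local Notation lambda := (@lebesgue_measure R).

Lemma integral_density1 (U : Y -> R) (g : R -> R) : is_density Q U g ->
  \int[lambda]_x (g x)%:E = 1.
Proof. by move=> [_ [_ <-//]]; rewrite preimage_setT probability_setT. Qed.

(* Obtained from the Radon-Nikodym theorem: [g] is a version of the derivative
   of the law of [U]. *)
Lemma ge0_integral_density (U : Y -> R) (g : R -> R) (h : R -> \bar R) :
  measurable_fun setT U -> is_density Q U g ->
  measurable_fun setT h -> (forall x, 0 <= h x) ->
  \int[Q]_y h (U y) = \int[lambda]_x (h x * (g x)%:E).
Proof.
move=> mU dg mh h0.
have [mg [g0 QUg]] := dg.
pose nuF := law Q (mU : measurable_fun setT (U : Y -> RM)).
have nuE (A : set R) : measurable A -> nuF A = \int[lambda]_(x in A) (g x)%:E.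
  by move=> mA; exact: QUg.
have numu : nuF `<< lambda.
  apply/null_content_dominatesP => A mA A0; rewrite nuE//.
  apply: null_set_integral => //; apply/measurable_EFinP.
  exact: measurable_funTS.
have := @ge0_integral_pushforward _ _ Y RM R U mU Q setT h measurableT mh
  (fun y _ => h0 y).
rewrite preimage_setT => Qh; transitivity (\int[nuF]_y h y); first exact/esym.
rewrite -(Radon_Nikodym_SigmaFinite.change_of_variables numu)//.
apply: ae_eq_integral => //.
- apply: emeasurable_funM => //.
  exact: measurable_int (Radon_Nikodym_SigmaFinite.f_integrable _).
- by apply: emeasurable_funM => //; exact/measurable_EFinP.
- apply: ae_eqe_mul2l; apply: integral_ae_eq => //.
  + exact: Radon_Nikodym_SigmaFinite.f_integrable.
  + exact/measurable_EFinP.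
  + move=> E _ mE; rewrite -nuE//.
    by rewrite -Radon_Nikodym_SigmaFinite.f_integral.
Qed.

(** The law of [U] gives the zero set of [g] the mass [\int g] over that set, which is 0. *)
Lemma ae_density_gt0 (U : Y -> R) (g : R -> R) : measurable_fun setT U ->
  is_density Q U g -> {ae Q, forall y, (0 < g (U y))%R}.
Proof.
move=> mU [mg [g0 QUg]].
have mA : measurable (g @^-1` [set 0%R]).
  by rewrite -[X in measurable X]setTI; exact: mg.
exists (U @^-1` (g @^-1` [set 0%R])); split.
- by rewrite -[X in measurable X]setTI; exact: mU.
- rewrite /= QUg// integral0_eq// => x /=.
  by rewrite /preimage/= => ->.
- move=> y /= /negP; rewrite -leNgt => gU.
  by rewrite /preimage/=; apply/eqP; rewrite eq_le gU g0.
Qed.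

(** The change of variables turns the mean of [|ln (g U)|] into the integral of [|g ln g|]. *)
Lemma integrable_ln_density (U : Y -> R) (g : R -> R) : measurable_fun setT U ->
  is_density Q U g -> entropy_finite g ->
  Q.-integrable setT (fun y => (ln (g (U y)))%:E).
Proof.
move=> mU dg /integrableP[mgl gloo]; have [mg [g0 _]] := dg.
have ml : measurable_fun setT (fun x => (ln (g x))%:E).
  by apply/measurable_EFinP; exact: measurableT_comp.
apply/integrableP; split; first exact: (measurableT_comp ml).
rewrite (ge0_integral_density (h := fun x => `|(ln (g x))%:E|) mU dg)//; last first.
  exact: measurableT_comp.
by under eq_integral do
  rewrite -{2}(ger0_norm (g0 _)) -EFinM mulrC -normrM.
Qed.

Lemma integral_ln_density (U : Y -> R) (g : R -> R) : measurable_fun setT U ->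
  is_density Q U g -> entropy_finite g ->
  \int[Q]_y (ln (g (U y)))%:E = (- diff_entropy g)%:E.
Proof.
move=> mU dg gfin; have [mg [g0 _]] := dg.
have ml : measurable_fun setT (fun x => (ln (g x))%:E).
  by apply/measurable_EFinP; exact: measurableT_comp.
rewrite /diff_entropy opprK /Rintegral fineK; last exact: integrable_fin_num.
(* The change of variables is for nonnegative functions, so positive and negative parts are treated
   separately; multiplying by [g >= 0] commutes with both. *)
rewrite [LHS]integralE [RHS]integralE; congr (_ - _).
- transitivity (\int[Q]_y (fun x => (ln (g x))%:E)^\+ (U y)).
    by apply: eq_integral => y _; rewrite !funeposE.
  rewrite (ge0_integral_density (h := (fun x => (ln (g x))%:E)^\+) mU dg)//; last first.
    exact: measurable_funepos.
  apply: eq_integral => x _ /=.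
  by rewrite !funeposE /= -!EFin_max -EFinM maxr_pMl// mul0r mulrC.
- transitivity (\int[Q]_y (fun x => (ln (g x))%:E)^\- (U y)).
    by apply: eq_integral => y _; rewrite !funenegE.
  rewrite (ge0_integral_density (h := (fun x => (ln (g x))%:E)^\-) mU dg)//; last first.
    exact: measurable_funeneg.
  apply: eq_integral => x _ /=.
  by rewrite !funenegE /= -!EFin_max -EFinM maxr_pMl// mul0r mulNr mulrC.
Qed.

End density.

(** * Tonelli's theorem with Lebesgue measure as second factor *)

Section tonelli_lebesgue.
Local Open Scope ereal_scope.
Context (d : measure_display) (Y : measurableType d) (R : realType).
Context (m : {sigma_finite_measure set Y -> \bar R}).
Local Notation RM := (measurableTypeR R).
Local Notation lambda := (@lebesgue_measure R).
Context (F : Y * R -> \bar R) (mF : measurable_fun setT F).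
Hypothesis F0 : forall z, 0 <= F z.

Lemma tonelli_lebesgue :
  \int[m]_y \int[lambda]_x F (y, x) = \int[lambda]_x \int[m]_y F (y, x).
Proof. exact: (@fubini_tonelli _ _ Y RM R m lambda F mF F0). Qed.

Lemma measurable_fun_integral_lebesgue :
  measurable_fun setT (fun y => \int[lambda]_x F (y, x)).
Proof. exact: (@measurable_fun_fubini_tonelli_F _ _ Y RM R lambda F mF F0). Qed.

Lemma measurable_fun_integral_fst :
  measurable_fun setT (fun x : R => \int[m]_y F (y, x)).
Proof. exact: (@measurable_fun_fubini_tonelli_G _ _ Y RM R m F mF F0). Qed.

End tonelli_lebesgue.

(** * From a pointwise bound to the sign of a mean *)

Section integral_le0.
Local Open Scope ereal_scope.
Context (d : measure_display) (Y : measurableType d) (R : realType).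
Context (Q : probability Y R).

(** Integrating [L + c <= Z] gives [E L + c <= E Z <= c], and the finite [c] cancels. *)
Lemma integral_le0_of_ae_le (L Z : Y -> R) (c : R) :
  Q.-integrable setT (EFin \o L) -> measurable_fun setT Z ->
  (forall y, 0 <= Z y)%R -> \int[Q]_y (Z y)%:E <= c%:E ->
  {ae Q, forall y, (L y <= Z y - c)%R} -> \int[Q]_y (L y)%:E <= 0.
Proof.
move=> iL mZ Z0 Zc LZ.
have mL : measurable_fun setT L by apply/measurable_EFinP; exact: measurable_int iL.
have fL : \int[Q]_y (L y)%:E \is a fin_num by exact: integrable_fin_num.
have ic : Q.-integrable setT (cst c%:E) by exact: finite_measure_integrable_cst.
have E : \int[Q]_y (L y + c)%:E = \int[Q]_y (L y)%:E + c%:E.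
  under eq_integral do rewrite EFinD.
  rewrite integralD//; congr (_ + _).
  by rewrite integral_cst// [X in _ * X]probability_setT mule1.
rewrite -(leeD2rE _ _ (_ : c%:E \is a fin_num))// -E add0e.
apply: (le_trans _ Zc).
(* Since [Z >= 0], the truncation [max (L + c) 0] still lies below [Z]; being nonnegative, it can be
   compared almost everywhere. *)
apply: (@le_trans _ _ (\int[Q]_y (Num.max (L y + c) 0)%:E)).
  apply: le_integral => //.
  - under eq_fun do rewrite EFinD.
    exact: (integrableD _ iL ic).
  - have := integrable_funepos measurableT (integrableD measurableT iL ic).
    apply: eq_integrable => // y _; rewrite funeposE/= EFin_max//.
  - by move=> y _; rewrite lee_fin le_max lexx.
apply: ae_ge0_le_integral => //.
- by move=> y _; rewrite lee_fin le_max lexx orbT.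
- apply/measurable_EFinP; apply: measurable_maxr => //.
  exact: measurable_funD.
- by move=> y _; rewrite lee_fin.
- exact/measurable_EFinP.
- apply: filterS LZ => y LZ _; rewrite lee_fin ge_max Z0 andbT.
  by rewrite -lerBrDr.
Qed.

End integral_le0.

(** * Independence, product spaces and joint laws *)

Section independence.
Local Open Scope ereal_scope.
Context (R : realType).
Local Notation RM := (measurableTypeR R).

Lemma product_probability_fst (d d' : measure_display) (Y : measurableType d)
  (Y' : measurableType d') (Q : probability Y R) (Q' : probability Y' R)
  (U : Y -> R) (A : set R) : measurable_fun setT U -> measurable A ->
  (Q \x Q') ((fun z => U z.1) @^-1` A) = Q (U @^-1` A).
Proof.
move=> mU mA; rewrite (_ : _ @^-1` A = (U @^-1` A) `*` setT); last first.
  by apply/seteqP; split => z /=; [split|case].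
rewrite product_measure1E//; first by rewrite [X in _ * X]probability_setT mule1.
by rewrite -[X in measurable X]setTI; exact: mU.
Qed.

Lemma product_probability_snd (d d' : measure_display) (Y : measurableType d)
  (Y' : measurableType d') (Q : probability Y R) (Q' : probability Y' R)
  (V : Y' -> R) (B : set R) : measurable_fun setT V -> measurable B ->
  (Q \x Q') ((fun z => V z.2) @^-1` B) = Q' (V @^-1` B).
Proof.
move=> mV mB; rewrite (_ : _ @^-1` B = setT `*` (V @^-1` B)); last first.
  by apply/seteqP; split => z /=; [split|case].
rewrite product_measure1E//; first by rewrite [X in X * _]probability_setT mul1e.
by rewrite -[X in measurable X]setTI; exact: mV.
Qed.

Lemma indep2_product (d d' : measure_display) (Y : measurableType d)
  (Y' : measurableType d') (Q : probability Y R) (Q' : probability Y' R)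
  (U : Y -> R) (V : Y' -> R) :
  measurable_fun setT U -> measurable_fun setT V ->
  indep2 ((Q \x Q') : probability (Y * Y')%type R)
    (fun z => U z.1) (fun z => V z.2).
Proof.
move=> mU mV A B mA mB.
have mUA : measurable (U @^-1` A) by rewrite -[X in measurable X]setTI; exact: mU.
have mVB : measurable (V @^-1` B) by rewrite -[X in measurable X]setTI; exact: mV.
transitivity (Q (U @^-1` A) * Q' (V @^-1` B)).
  by rewrite -product_measure1E.
by congr (_ * _); apply/esym;
  [exact: product_probability_fst|exact: product_probability_snd].
Qed.

(** Both joint laws equal the product of the common marginals, by uniqueness of the product
    measure. *)
Lemma ge0_integral_indep_pair (d d' : measure_display) (Y : measurableType d)
  (Y' : measurableType d') (Q : probability Y R) (Q' : probability Y' R)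
  (U V : Y -> R) (U' V' : Y' -> R) (G : R * R -> \bar R) :
  measurable_fun setT U -> measurable_fun setT V ->
  measurable_fun setT U' -> measurable_fun setT V' ->
  indep2 Q U V -> indep2 Q' U' V' ->
  (forall A : set R, measurable A -> Q (U @^-1` A) = Q' (U' @^-1` A)) ->
  (forall A : set R, measurable A -> Q (V @^-1` A) = Q' (V' @^-1` A)) ->
  measurable_fun setT G -> (forall z, 0 <= G z) ->
  \int[Q]_y G (U y, V y) = \int[Q']_y G (U' y, V' y).
Proof.
move=> mU mV mU' mV' QUV QUV' UU' VV' mG G0.
have mUV : measurable_fun setT (fun y => (U y, V y) : RM * RM).
  exact: (@measurable_fun_pair _ _ _ Y RM RM).
have mUV' : measurable_fun setT (fun y => (U' y, V' y) : RM * RM).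
  exact: (@measurable_fun_pair _ _ _ Y' RM RM).
have E1 := @ge0_integral_pushforward _ _ Y (RM * RM)%type R _ mUV Q setT G
  measurableT mG (fun y _ => G0 y).
have E2 := @ge0_integral_pushforward _ _ Y' (RM * RM)%type R _ mUV' Q' setT G
  measurableT mG (fun y _ => G0 y).
rewrite preimage_setT in E1; rewrite preimage_setT in E2.
apply: (etrans (esym E1)); apply: (etrans _ E2).
pose mu := law Q (mU : measurable_fun setT (U : Y -> RM)).
pose nu := law Q (mV : measurable_fun setT (V : Y -> RM)).
apply: eq_measure_integral => E mE _.
transitivity ((mu \x nu) E).
- by apply/esym/(@product_measure_unique _ _ RM RM R mu nu (law Q mUV)).
- apply: (@product_measure_unique _ _ RM RM R mu nu (law Q' mUV')) => // A B mA mB.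
  have := QUV' A B mA mB; rewrite -UU'// -VV'//.
Qed.

(** The pair [(U, V)] has the law of the coordinate pair [(U z.1, V z.2)] on [Y * Y], to which
    Tonelli applies. *)
Lemma ge0_integral_indep (d : measure_display) (Y : measurableType d)
  (Q : probability Y R) (U V : Y -> R) (G : R * R -> \bar R) :
  measurable_fun setT U -> measurable_fun setT V -> indep2 Q U V ->
  measurable_fun setT G -> (forall z, 0 <= G z) ->
  \int[Q]_y G (U y, V y) = \int[Q]_y \int[Q]_y' G (U y, V y').
Proof.
move=> mU mV QUV mG G0.
have mU1 : measurable_fun setT (fun z : Y * Y => U z.1) by exact: measurableT_comp.
have mV2 : measurable_fun setT (fun z : Y * Y => V z.2) by exact: measurableT_comp.
rewrite (ge0_integral_indep_pair mU mV mU1 mV2 QUV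
  (indep2_product Q Q mU mV))//.
- apply: (fubini_tonelli1 (fun z : Y * Y => G (U z.1, V z.2))) => //.
  by apply: measurableT_comp mG _; exact: measurable_fun_pair.
- by move=> A mA; apply/esym/product_probability_fst.
- by move=> A mA; apply/esym/product_probability_snd.
Qed.

(** On the slice where the second coordinate is [w], the second event constrains only [V], so
    independence of [U] and [V] factors the slice; integrating over [w] concludes. It serves to make
    [U] independent of [V - W]. *)
Lemma indep2_fst_comp (d d' : measure_display) (Y : measurableType d)
  (Y' : measurableType d') (Q : probability Y R) (Q' : probability Y' R)
  (U V : Y -> R) (W : Y' -> R) (phi : R * R -> R) :
  measurable_fun setT U -> measurable_fun setT V -> measurable_fun setT W ->
  measurable_fun setT phi -> indep2 Q U V ->
  indep2 ((Q \x Q') : probability (Y * Y')%type R)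
    (fun z => U z.1) (fun z => phi (V z.1, W z.2)).
Proof.
move=> mU mV mW mphi QUV A B mA mB.
have mVW : measurable_fun setT (fun z : Y * Y' => phi (V z.1, W z.2)).
  apply: (measurableT_comp mphi); apply: measurable_fun_pair;
  exact: measurableT_comp.
have mU1 : measurable_fun setT (fun z : Y * Y' => U z.1) by exact: measurableT_comp.
have mVWB : measurable ((fun z => phi (V z.1, W z.2)) @^-1` B).
  by rewrite -[X in measurable X]setTI; exact: mVW.
have mUA : measurable ((fun z : Y * Y' => U z.1) @^-1` A).
  by rewrite -[X in measurable X]setTI; exact: mU1.
(* The product measure is computed by slicing at a fixed second coordinate. *)
have ME (E : set (Y * Y')) : measurable E ->
    (Q \x Q') E = \int[Q']_w Q (ysection E w).
  move=> mE; apply: (product_measure_unique (m' := (Q \x^ Q'))) => //.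
  by move=> ? ? ? ?; exact: product_measure2E.
rewrite [LHS]ME; last exact: measurableI.
rewrite [X in X * _]product_probability_fst// [X in _ * X]ME//.
rewrite -ge0_integralZl//; last 1 first.
  exact: (measurable_fun_ysection Q).
apply: eq_integral => w _.
have ys (E : set (Y * Y')) : ysection E w = (pair^~ w) @^-1` E.
  by apply/seteqP; split => y /=; rewrite /ysection/= inE.
rewrite !ys preimage_setI; apply: (QUV A ((fun v => phi (v, W w)) @^-1` B)) => //.
rewrite -[X in measurable X]setTI.
by apply: (measurableT_comp mphi) => //; exact: measurable_fun_pair.
Qed.

Lemma is_density_indep_pair (d d' : measure_display) (Y : measurableType d)
  (Y' : measurableType d') (Q : probability Y R) (Q' : probability Y' R)
  (U V : Y -> R) (U' V' : Y' -> R) (phi : R * R -> R) (g : R -> R) :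
  measurable_fun setT U -> measurable_fun setT V ->
  measurable_fun setT U' -> measurable_fun setT V' ->
  indep2 Q U V -> indep2 Q' U' V' ->
  (forall A : set R, measurable A -> Q (U @^-1` A) = Q' (U' @^-1` A)) ->
  (forall A : set R, measurable A -> Q (V @^-1` A) = Q' (V' @^-1` A)) ->
  measurable_fun setT phi ->
  is_density Q (fun y => phi (U y, V y)) g ->
  is_density Q' (fun y => phi (U' y, V' y)) g.
Proof.
move=> mU mV mU' mV' QUV QUV' UU' VV' mphi [mg [g0 Qg]].
split; [exact: mg|split => // A mA]; rewrite -Qg//.
have mpA : measurable (phi @^-1` A).
  by rewrite -[X in measurable X]setTI; exact: mphi.
have mpair d0 (Y0 : measurableType d0) (U0 V0 : Y0 -> R) :
    measurable_fun setT U0 -> measurable_fun setT V0 ->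
    measurable ((fun y => phi (U0 y, V0 y)) @^-1` A).
  move=> mU0 mV0; rewrite -[X in measurable X]setTI.
  by apply: (measurableT_comp mphi) => //; exact: measurable_fun_pair.
have := ge0_integral_indep_pair mU mV mU' mV' QUV QUV' UU' VV'
  (G := fun z => (\1_(phi @^-1` A) z)%:E) _ (fun z => _).
move=> /(_ _ _) E.
rewrite -[X in Q' X]setIT -[X in Q X]setIT -!integral_indic//; [|exact: mpair..].
apply/esym/E.
- by apply/measurable_EFinP; exact: measurable_indic.
- by move=> z; rewrite lee_fin.
Qed.

End independence.

(** * Convolution density of an independent sum *)

Section density_of_sum.
Local Open Scope ereal_scope.
Context (d : measure_display) (Y : measurableType d) (R : realType).
Context (Q : probability Y R).
Local Notation lambda := (@lebesgue_measure R).

(** The density is the convolution [c |-> E m(c - U)]; only [D] has to have a density. The second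
    conclusion keeps this formula available. *)
Lemma is_density_add (U D : Y -> R) (m : R -> R) :
  measurable_fun setT U -> measurable_fun setT D -> indep2 Q U D ->
  is_density Q D m ->
  exists2 rho : R -> R, is_density Q (fun y => U y + D y)%R rho &
    {ae lambda, forall c : R, \int[Q]_y (m (c - U y))%:E = (rho c)%:E}.
Proof.
move=> mU mD QUD dm; have [mm [m0 _]] := dm.
pose K (z : Y * R) := (m (z.2 - U z.1))%:E.
have mK : measurable_fun setT K.
  apply/measurable_EFinP; apply: (measurableT_comp mm).
  by apply: measurable_funB => //; exact: measurableT_comp.
have mmc c : measurable_fun setT (fun x : R => m (x - c)%R).
  apply: (measurableT_comp mm).
  exact: (@measurable_funB _ R R setT id (cst c)).
have K0 z : 0 <= K z by rewrite lee_fin.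
pose r (c : R) := \int[Q]_y K (y, c).
have mr : measurable_fun setT r by exact: measurable_fun_integral_fst.
have r0 c : 0 <= r c by exact: integral_ge0.
have mUD : measurable_fun setT (fun y => U y + D y)%R by exact: measurable_funD.
have QA (A : set R) : measurable A ->
    Q ((fun y => U y + D y)%R @^-1` A) = \int[lambda]_(c in A) r c.
  move=> mA.
  have m1A : measurable_fun setT (\1_A : R -> R) by exact: measurable_indic.
  transitivity (\int[Q]_y (\1_A (U y + D y)%R)%:E).
    rewrite -[X in Q X]setIT -integral_indic//.
    by rewrite -[X in measurable X]setTI; exact: mUD.
  rewrite (ge0_integral_indep (G := fun z => (\1_A (z.1 + z.2)%R)%:E) mU mD QUD)//=; last first.
    apply/measurable_EFinP; apply: (measurableT_comp m1A).
    exact: measurable_funD.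
  transitivity (\int[Q]_y \int[lambda]_x ((\1_A x)%:E * K (y, x))).
    apply: eq_integral => y _.
    rewrite (ge0_integral_density (h := fun x => (\1_A (U y + x)%R)%:E) mD dm)//; last first.
      apply/measurable_EFinP; apply: (measurableT_comp m1A).
      exact: measurable_funD.
    (* The substitution [c = U y + x] moves [U y] from the indicator into [m]. *)
    rewrite -(ge0_integral_shift (U y) (h := fun x => (\1_A x)%:E * K (y, x))).
    - by apply: eq_integral => x _; rewrite /K/= addrK addrC.
    - apply: emeasurable_funM; first exact/measurable_EFinP.
      by apply/measurable_EFinP; exact: (mmc (U y)).
    - by move=> x; rewrite mule_ge0// lee_fin.
  rewrite (@tonelli_lebesgue _ _ _ Q (fun z => (\1_A z.2)%:E * K z))/=; last 2 first.
    apply: emeasurable_funM => //; apply/measurable_EFinP.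
    exact: (measurableT_comp m1A).
    by move=> x; rewrite mule_ge0// lee_fin.
  rewrite [RHS]integral_mkcond; apply: eq_integral => x _.
  rewrite ge0_integralZl_EFin//; last first.
    apply/measurable_EFinP; apply: (measurableT_comp mm).
    exact: (@measurable_funB _ Y R setT (cst x) U).
  by rewrite patchE indicE; case: ifPn => _; rewrite ?mul1e ?mul0e.
have ir : lambda.-integrable setT r.
  apply/integrableP; split=> //.
  under eq_integral do rewrite gee0_abs//.
  by rewrite -QA// preimage_setT probability_setT ltry.
(* The convolution may be infinite on a null set; its integral is 1, so [fine] changes it only
   there. *)
have ae_r : {ae lambda, forall c, r c = (fine (r c))%:E}.
  apply: filterS (integrable_ae measurableT ir) => c rc.
  by rewrite fineK// rc.
exists (fine \o r) => //.
have mf : measurable_fun setT (fine \o r).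
  by apply: measurableT_comp => //; exact: fine_measurable.
split; [exact: mf|split => [x|A mA]]; first exact: fine_ge0.
rewrite QA//; apply: ae_eq_integral => //.
- exact: measurable_funTS.
- by apply/measurable_EFinP; exact: measurable_funTS.
- by apply: (@filterS _ _ (ae_filter_ringOfSetsType lambda) _ _ _ ae_r) => c rc _.
Qed.

End density_of_sum.

(** * Measurability of inverses, and automation *)

Section measurability.
Context (d : measure_display) (Y : measurableType d) (R : realType).

Lemma ge0_measurable_funV (g : Y -> R) : measurable_fun setT g ->
  (forall y, 0 <= g y) -> measurable_fun setT (fun y => (g y)^-1).
Proof.
move=> mg g0.
(* On nonnegative reals inversion is the power [-1], also at 0, and powers are measurable. *)
rewrite (_ : (fun y => _) = (fun y => g y `^ (-1))); last first.
  by apply/funext => y; rewrite powR_inv1.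
exact: (measurableT_comp (@measurable_powR R (-1)) mg).
Qed.

End measurability.

(** Decomposes along the syntax; each inverse leaves a nonnegativity goal to the caller. *)
Ltac measurability := repeat lazymatch goal with
  | |- measurable_fun _ (fun z => EFin (@?a z)) => apply/measurable_EFinP
  | |- measurable_fun _ (fun z => (@?a z - @?b z)%R) =>
      apply: (@measurable_funB _ _ _ _ a b)
  | |- measurable_fun _ (fun z => (@?a z + @?b z)%R) =>
      apply: (@measurable_funD _ _ _ _ a b)
  | |- measurable_fun _ (fun z => (@?a z * @?b z)%R) =>
      apply: (@measurable_funM _ _ _ _ a b)
  | |- measurable_fun _ (fun z => (@?a z * @?b z)%E) =>
      apply: (@emeasurable_funM _ _ _ _ a b)
  | |- measurable_fun _ (fun z => ((@?a z)^-1)%R) =>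
      apply: (@ge0_measurable_funV _ _ _ a)
  | H : measurable_fun _ ?g |- measurable_fun _ (fun z => ?g (@?a z)) =>
      first [exact: H | apply: (@measurableT_comp _ _ _ _ _ _ g _ a H)]
  | |- measurable_fun _ _ =>
      first [exact: measurable_fst | exact: measurable_snd | by []]
  end.

(** * Entropy inequalities from a ratio of densities *)

Section entropy_comparison.
Local Open Scope ereal_scope.
Context (d : measure_display) (Y : measurableType d) (R : realType).
Context (Q : probability Y R).

Lemma ln_le_subr1 (x : R) : (0 < x)%R -> (ln x <= x - 1)%R.
Proof.
move=> x0; have := @le_ln1Dx R (x - 1).
by rewrite [X in ln X]addrC subrK; apply; rewrite ltrBrDl subrr.
Qed.

(** The mean of each log-density is minus an entropy, so the claim is that the log-ratio has mean at
    most 0. The bound [Z - c] covers one use of [ln x <= x - 1] ([c = 1]) or the sum of two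
    ([c = 2]). *)
Lemma diff_entropy_le (A1 A2 B1 B2 Z : Y -> R) (g1 g2 k1 k2 : R -> R) (c : R) :
  measurable_fun setT A1 -> measurable_fun setT A2 ->
  measurable_fun setT B1 -> measurable_fun setT B2 ->
  is_density Q A1 g1 -> is_density Q A2 g2 ->
  is_density Q B1 k1 -> is_density Q B2 k2 ->
  entropy_finite g1 -> entropy_finite g2 ->
  entropy_finite k1 -> entropy_finite k2 ->
  measurable_fun setT Z -> (forall y, 0 <= Z y)%R ->
  \int[Q]_y (Z y)%:E <= c%:E ->
  {ae Q, forall y,
    (0 < g1 (A1 y))%R -> (0 < g2 (A2 y))%R ->
    (0 < k1 (B1 y))%R -> (0 < k2 (B2 y))%R ->
    (ln (g1 (A1 y) * g2 (A2 y) / (k1 (B1 y) * k2 (B2 y))) <= Z y - c)%R} ->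
  (diff_entropy k1 + diff_entropy k2 <= diff_entropy g1 + diff_entropy g2)%R.
Proof.
move=> mA1 mA2 mB1 mB2 dA1 dA2 dB1 dB2 fA1 fA2 fB1 fB2 mZ Z0 Zc LZ.
have iA1 := integrable_ln_density mA1 dA1 fA1.
have iA2 := integrable_ln_density mA2 dA2 fA2.
have iB1 := integrable_ln_density mB1 dB1 fB1.
have iB2 := integrable_ln_density mB2 dB2 fB2.
have iA := integrableD measurableT iA1 iA2.
have iB := integrableD measurableT iB1 iB2.
have iL := integrableB measurableT iA iB.
pose L y := (ln (g1 (A1 y)) + ln (g2 (A2 y)) -
  (ln (k1 (B1 y)) + ln (k2 (B2 y))))%R.
have := @integral_le0_of_ae_le _ _ _ Q L Z c iL mZ Z0 Zc.
have -> : \int[Q]_y (L y)%:E =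
    (- diff_entropy g1 - diff_entropy g2 +
     (diff_entropy k1 + diff_entropy k2))%:E.
  transitivity (\int[Q]_y (((fun y => (ln (g1 (A1 y)))%:E) \+
      (fun y => (ln (g2 (A2 y)))%:E)) y -
    ((fun y => (ln (k1 (B1 y)))%:E) \+ (fun y => (ln (k2 (B2 y)))%:E)) y)) => //.
  rewrite integralB//= integralD// integralD// !integral_ln_density//.
  by rewrite -!EFinD opprD !opprK.
rewrite lee_fin => H.
suff /H : {ae Q, forall y, (L y <= Z y - c)%R}.
  by rewrite -opprD addrC subr_le0.
have FQ := ae_filter_ringOfSetsType Q.
(* The logarithm of the ratio splits where all four densities are positive, which is almost
   everywhere. *)
have pA := @filterI _ _ FQ _ _ (ae_density_gt0 mA1 dA1) (ae_density_gt0 mA2 dA2).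
have pB := @filterI _ _ FQ _ _ (ae_density_gt0 mB1 dB1) (ae_density_gt0 mB2 dB2).
apply: (@filterS3 _ _ FQ _ _ _ _ _ LZ pA pB) => y LZy [a1 a2] [b1 b2].
apply: le_trans (LZy a1 a2 b1 b2).
by rewrite /L ln_div ?posrE ?mulr_gt0// !lnM ?posrE.
Qed.

End entropy_comparison.

(** * Three independent copies and the densities of their sums and differences *)

Section sum_difference.
Local Open Scope ereal_scope.
Context (d : measure_display) (T : measurableType d) (R : realType).
Context (P : probability T R) (X1 X2 : T -> R) (f p m : R -> R).
Local Notation lambda := (@lebesgue_measure R).
Context (mX1 : measurable_fun setT X1) (mX2 : measurable_fun setT X2).
Context (X12 : indep2 P X1 X2) (dX1 : is_density P X1 f).
Context (dX2 : is_density P X2 f).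
Context (dp : is_density P (fun w => X1 w + X2 w)%R p).
Context (dm : is_density P (fun w => X1 w - X2 w)%R m).

Let mf : measurable_fun setT f. Proof. by case: dX1. Qed.
Let mp : measurable_fun setT p. Proof. by case: dp. Qed.
Let mm : measurable_fun setT m. Proof. by case: dm. Qed.
Let f0 x : (0 <= f x)%R. Proof. by case: dX1 => _ []. Qed.
Let p0 x : (0 <= p x)%R. Proof. by case: dp => _ []. Qed.
Let m0 x : (0 <= m x)%R. Proof. by case: dm => _ []. Qed.

(** Two copies of the sample space suffice: the first carries the original pair [(U, V)], the second
    an independent [W]. *)
Let M : probability (T * T)%type R := (P \x P).
Let U (z : T * T) := X1 z.1.
Let V (z : T * T) := X2 z.1.
Let W (z : T * T) := X2 z.2.

Let mU : measurable_fun setT U. Proof. exact: measurableT_comp. Qed.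
Let mV : measurable_fun setT V. Proof. exact: measurableT_comp. Qed.
Let mW : measurable_fun setT W. Proof. exact: measurableT_comp. Qed.

Let PU (A : set R) : measurable A -> P (X1 @^-1` A) = M (U @^-1` A).
Proof. by move=> mA; apply/esym/product_probability_fst. Qed.

Let PV (A : set R) : measurable A -> P (X2 @^-1` A) = M (V @^-1` A).
Proof. by move=> mA; apply/esym/product_probability_fst. Qed.

Let PW (A : set R) : measurable A -> P (X2 @^-1` A) = M (W @^-1` A).
Proof. by move=> mA; apply/esym/product_probability_snd. Qed.

Let X1X2 (A : set R) : measurable A -> P (X1 @^-1` A) = P (X2 @^-1` A).
Proof. by move=> mA; rewrite dX1.2.2// dX2.2.2. Qed.

Let dU : is_density M U f.
Proof. by split; [|split] => // A mA; rewrite -PU// dX1.2.2. Qed.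

Let dW : is_density M W f.
Proof. by split; [|split] => // A mA; rewrite -PW// dX2.2.2. Qed.

Let msum : measurable_fun setT (fun z : R * R => z.1 + z.2)%R.
Proof. exact: measurable_funD. Qed.

Let mdiff : measurable_fun setT (fun z : R * R => z.1 - z.2)%R.
Proof. exact: measurable_funB. Qed.

Let dUV_sum : is_density M (fun z => U z + V z)%R p.
Proof.
split; [|split] => // A mA; rewrite -dp.2.2//.
by apply: (product_probability_fst P P (U := fun w => X1 w + X2 w)%R) => //;
  exact: measurable_funD.
Qed.

Let dUV_diff : is_density M (fun z => U z - V z)%R m.
Proof.
split; [|split] => // A mA; rewrite -dm.2.2//.
by apply: (product_probability_fst P P (U := fun w => X1 w - X2 w)%R) => //;
  exact: measurable_funB.
Qed.

Let UW : indep2 M U W. Proof. exact: indep2_product. Qed.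
Let VW : indep2 M V W. Proof. exact: indep2_product. Qed.

Let dUW_sum : is_density M (fun z => U z + W z)%R p.
Proof.
exact: (is_density_indep_pair mX1 mX2 mU mW X12 UW PU PW msum dp).
Qed.

(** Lets [V] stand in for [X1], so that [(V, W)] has the joint law of [(X1, X2)]. *)
Let PV1 (A : set R) : measurable A -> P (X1 @^-1` A) = M (V @^-1` A).
Proof. by move=> mA; rewrite X1X2// PV. Qed.

Let dVW_sum : is_density M (fun z => V z + W z)%R p.
Proof.
exact: (is_density_indep_pair mX1 mX2 mV mW X12 VW PV1 PW msum dp).
Qed.

Let dUW_diff : is_density M (fun z => U z - W z)%R m.
Proof.
exact: (is_density_indep_pair mX1 mX2 mU mW X12 UW PU PW mdiff dm).
Qed.

Let dVW_diff : is_density M (fun z => V z - W z)%R m.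
Proof.
exact: (is_density_indep_pair mX1 mX2 mV mW X12 VW PV1 PW mdiff dm).
Qed.

(** An inequality because division by 0 yields 0: at [c = 0] the left side vanishes. *)
Let ler_divM_cancel (a b c : R) : (0 <= a -> 0 <= b -> 0 <= c ->
  a / (b * c) * c <= b^-1 * a)%R.
Proof.
move=> a0 b0 c0; have [->|c1] := eqVneq c 0%R.
  by rewrite mulr0 mulr_ge0// invr_ge0.
by rewrite invfM mulrA mulfVK// mulrC.
Qed.

(** * The inequality [h(X1 - X2) + h <= 2 h(X1 + X2)] *)

Let Z z := (p (U z + W z) * p (V z + W z) / (m (U z - V z) * f (W z)))%R.

Let mZ : measurable_fun setT Z.
Proof. by rewrite /Z; measurability => z; rewrite mulr_ge0. Qed.

Let Z0 z : (0 <= Z z)%R.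
Proof. by rewrite /Z divr_ge0// mulr_ge0. Qed.

Let integral_Z : \int[M]_z (Z z)%:E <= 1.
Proof.
(* Integrating [W] out of [Z] leaves [q / m] at [U - V]. As the density of the difference of two
   independent variables of density [p], [q] has total mass 1. *)
pose q u := \int[lambda]_t (p (u + t) * p t)%:E.
have mpp : measurable_fun setT (fun z : R * R => (p (z.1 + z.2) * p z.2)%:E).
  by measurability.
have pp0 (z : R * R) : 0 <= (p (z.1 + z.2) * p z.2)%:E.
  by rewrite lee_fin mulr_ge0.
have mq : measurable_fun setT q.
  exact: (@measurable_fun_integral_lebesgue _ _ R _ mpp pp0).
have q0 u : 0 <= q u by apply: integral_ge0 => t _; rewrite lee_fin mulr_ge0.
have int_q : \int[lambda]_u q u = 1.
  rewrite (@tonelli_lebesgue _ _ R lambda _ mpp pp0)/=.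
  rewrite -(integral_density1 dp); apply: eq_integral => t _.
  under eq_integral do rewrite mulrC EFinM.
  rewrite ge0_integralZl_EFin//=.
  - rewrite (@ge0_integral_shift R t (EFin \o p)); [|exact/measurable_EFinP|].
      by rewrite (integral_density1 dp) mule1.
    by move=> x; rewrite lee_fin.
  - by move=> x _; rewrite lee_fin.
  - by measurability.
apply: (@le_trans _ _ (\int[P]_w ((m (X1 w - X2 w))^-1%:E * q (X1 w - X2 w)%R))).
  rewrite (fubini_tonelli1 (EFin \o Z))//; last exact/measurable_EFinP.
  apply: ge0_le_integral => //.
  - by move=> w _; apply: integral_ge0 => w' _; rewrite lee_fin.
  - apply: (measurable_fun_fubini_tonelli_F (EFin \o Z)) => //.
    exact/measurable_EFinP.
  - apply: emeasurable_funM; first by measurability.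
    apply: (measurableT_comp mq); exact: measurable_funB.
  move=> w _; rewrite /fubini_F/=.
  rewrite (ge0_integral_density (h := fun x => (p (X1 w + x) * p (X2 w + x) /
    (m (X1 w - X2 w) * f x))%:E) mX2 dX2); last 2 first.
    by measurability => // x; rewrite mulr_ge0.
    by move=> x; rewrite lee_fin divr_ge0// mulr_ge0.
  (* Translating the integration variable by [X2 w] shows dependence on the difference alone. *)
  have -> : q (X1 w - X2 w)%R =
      \int[lambda]_x (p (X1 w + x) * p (X2 w + x))%:E.
    rewrite /q -(ge0_integral_shift (X2 w)); last 2 first.
      by measurability.
      by move=> x; rewrite lee_fin mulr_ge0.
    apply: eq_integral => x _; congr ((p _ * p _)%:E)%R; last by rewrite addrC.
    by rewrite (addrC x) addrA subrK.
  rewrite -ge0_integralZl_EFin//; last 3 first.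
    by move=> x _; rewrite lee_fin mulr_ge0.
    by measurability.
    by rewrite invr_ge0.
  apply: ge0_le_integral => //.
  - by move=> x _; rewrite -EFinM lee_fin mulr_ge0// divr_ge0// mulr_ge0.
  - by measurability => // x; rewrite mulr_ge0.
  - by measurability.
  - by move=> x _; rewrite -!EFinM lee_fin ler_divM_cancel// mulr_ge0.
(* Integrating against the law of [X1 - X2] supplies the factor [m] that cancels its inverse. *)
rewrite (ge0_integral_density (h := fun u => (m u)^-1%:E * q u) _ dm); last 3 first.
  exact: measurable_funB.
  by apply: emeasurable_funM => //; measurability.
  by move=> u; rewrite mule_ge0// lee_fin invr_ge0.
rewrite -int_q; apply: ge0_le_integral => //.
- by move=> u _; rewrite mule_ge0 ?lee_fin// mule_ge0// lee_fin invr_ge0.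
- by apply: emeasurable_funM; [apply: emeasurable_funM => //|]; measurability.
- move=> u _; have [->|mu] := eqVneq (m u) 0%R; first by rewrite mule0.
  by rewrite muleAC -EFinM mulVf// mul1e.
Qed.

Lemma diff_entropy_minus_le : entropy_finite f -> entropy_finite p ->
  entropy_finite m ->
  (diff_entropy m + diff_entropy f <= diff_entropy p + diff_entropy p)%R.
Proof.
move=> ff fp fm.
apply: (diff_entropy_le _ _ _ _ dUW_sum dVW_sum dUV_diff dW fp fp fm ff mZ Z0 integral_Z).
- exact: measurable_funD.
- exact: measurable_funD.
- exact: measurable_funB.
- exact: mW.
by apply: aeW => z *; apply: ln_le_subr1; rewrite divr_gt0// mulr_gt0.
Qed.

(** * The inequality [h(X1 + X2) + h <= 2 h(X1 - X2)], given a density of [U + V - W] *)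

Section triple_sum.
(** [rhoE] identifies [rho] with the convolution on which the mean of [Za] relies. *)
Context (rho : R -> R).
Context (drho : is_density M (fun z => U z + (V z - W z))%R rho).
Context (rhoE : {ae lambda, forall c : R,
  \int[M]_z (m (c - U z))%:E = (rho c)%:E}).

Let mrho : measurable_fun setT rho. Proof. by case: drho. Qed.
Let rho0 x : (0 <= rho x)%R. Proof. by case: drho => _ []. Qed.

Let Za z := (m (U z - W z) * m (V z - W z) /
  (rho (U z + (V z - W z)) * f (W z)))%R.
Let Zb z := (rho (U z + (V z - W z)) / p (U z + V z))%R.

Let mZa : measurable_fun setT Za.
Proof. by rewrite /Za; measurability => z; rewrite mulr_ge0. Qed.

Let Za0 z : (0 <= Za z)%R. Proof. by rewrite /Za divr_ge0// mulr_ge0. Qed.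

Let mZb : measurable_fun setT Zb. Proof. by rewrite /Zb; measurability. Qed.

Let Zb0 z : (0 <= Zb z)%R. Proof. by rewrite /Zb divr_ge0. Qed.

(** For fixed [W], the density [p] of [U + V] cancels the denominator and leaves a translate of
    [rho], of mass 1. *)
Let integral_Zb : \int[M]_z (Zb z)%:E <= 1.
Proof.
rewrite (fubini_tonelli2 (EFin \o Zb))//; last exact/measurable_EFinP.
apply: (@le_trans _ _ (\int[P]_w (cst 1) w)); last first.
  by rewrite integral_cst// mul1e [X in X <= _]probability_setT.
apply: ge0_le_integral => //.
- by move=> w _; apply: integral_ge0 => w' _; rewrite lee_fin.
- apply: (measurable_fun_fubini_tonelli_G (EFin \o Zb)) => //.
  exact/measurable_EFinP.
move=> w' _; rewrite /fubini_G/=.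
have -> : \int[P]_w (Zb (w, w'))%:E =
    \int[P]_w (rho (X1 w + X2 w - X2 w') / p (X1 w + X2 w))%:E.
  by under eq_integral do rewrite /Zb /U /V /W/= addrA.
rewrite (ge0_integral_density (h := fun s => (rho (s - X2 w') / p s)%:E) _ dp);
  last 3 first.
  exact: measurable_funD.
  by measurability.
  by move=> s; rewrite lee_fin divr_ge0.
apply: (@le_trans _ _ (\int[lambda]_s (rho (s - X2 w'))%:E)).
  apply: ge0_le_integral => //.
  - by move=> s _; rewrite -EFinM lee_fin mulr_ge0// divr_ge0.
  - by measurability.
  - by measurability.
  - move=> s _; rewrite -EFinM lee_fin; have [->|ps] := eqVneq (p s) 0%R.
      by rewrite mulr0.
    by rewrite mulfVK.
rewrite (@ge0_integral_shift R (- X2 w') (EFin \o rho)).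
- by rewrite (integral_density1 drho).
- exact/measurable_EFinP.
- by move=> s; rewrite lee_fin.
Qed.

(** Integrate [W] out, so that [f] cancels, and change variables to [c = U + V - W]. By independence
    the numerator then averages to [rho(c)^2], so the mean is at most the integral of
    [rho^2 / rho]. *)
Let integral_Za : \int[M]_z (Za z)%:E <= 1.
Proof.
pose r (c : R) := \int[lambda]_x ((m (c - x))%:E * (f x)%:E).
have mmc c : measurable_fun setT (fun x : R => (m (c - x))%:E) by measurability.
have mmc0 c (x : R) : 0 <= (m (c - x))%:E by rewrite lee_fin.
have r1 c : \int[P]_w (m (c - X1 w))%:E = r c.
  exact: (ge0_integral_density mX1 dX1 (mmc c) (mmc0 c)).
have r2 c : \int[P]_w (m (c - X2 w))%:E = r c.
  exact: (ge0_integral_density mX2 dX2 (mmc c) (mmc0 c)).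
have rU c : \int[M]_z (m (c - U z))%:E = r c.
  exact: (ge0_integral_density mU dU (mmc c) (mmc0 c)).
(* In the variable [c = U + V - W], [U - W] is [c - V] and [V - W] is [c - U]. *)
pose K (z : T * R) := ((rho z.2)^-1 * (m (z.2 - X1 z.1) * m (z.2 - X2 z.1)))%:E.
have mK : measurable_fun setT K by rewrite /K; measurability.
have K0 z : 0 <= K z by rewrite lee_fin !mulr_ge0// invr_ge0.
have PK c : \int[P]_w K (w, c) = (rho c)^-1%:E * (r c * r c).
  rewrite /K/=; under eq_integral do rewrite EFinM.
  rewrite ge0_integralZl_EFin//; last 3 first.
    by move=> w _; rewrite lee_fin mulr_ge0.
    by measurability.
    by rewrite invr_ge0.
  congr (_ * _).
  rewrite (ge0_integral_indep (G := fun z => (m (c - z.1) * m (c - z.2))%:E)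
    mX1 mX2 X12)/=; last 2 first.
    by measurability.
    by move=> z; rewrite lee_fin mulr_ge0.
  transitivity (\int[P]_w ((m (c - X1 w))%:E * r c)).
    apply: eq_integral => w _; under eq_integral do rewrite EFinM.
    rewrite ge0_integralZl_EFin ?r2//.
    by measurability.
  rewrite ge0_integralZr ?r1//; first by measurability.
  by apply: integral_ge0 => x _; rewrite mule_ge0// lee_fin.
apply: (@le_trans _ _ (\int[P]_w \int[lambda]_c K (w, c))).
  rewrite (fubini_tonelli1 (EFin \o Za))//; last exact/measurable_EFinP.
  apply: ge0_le_integral => //.
  - by move=> w _; apply: integral_ge0 => w' _; rewrite lee_fin.
  - apply: (measurable_fun_fubini_tonelli_F (EFin \o Za)) => //.
    exact/measurable_EFinP.
  - exact: measurable_fun_integral_lebesgue.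
  move=> w _; rewrite /fubini_F/=.
  rewrite (ge0_integral_density (h := fun x => (m (X1 w - x) * m (X2 w - x) /
    (rho (X1 w + (X2 w - x)) * f x))%:E) mX2 dX2); last 2 first.
    by measurability => // x; rewrite mulr_ge0.
    by move=> x; rewrite lee_fin divr_ge0// mulr_ge0.
  rewrite -(@ge0_integral_reflect R (X1 w + X2 w) (fun c => K (w, c))); last 2 first.
    by rewrite /K/=; measurability.
    by move=> x.
  apply: ge0_le_integral => //.
  - by move=> x _; rewrite -EFinM lee_fin mulr_ge0// divr_ge0// mulr_ge0.
  - by measurability => // x; rewrite mulr_ge0.
  - by rewrite /K/=; measurability.
  - move=> x _; rewrite -EFinM lee_fin/= -addrA.
    have -> : (X1 w + (X2 w - x) - X1 w = X2 w - x)%R by rewrite addrAC subrr add0r.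
    have -> : (X1 w + (X2 w - x) - X2 w = X1 w - x)%R.
      by rewrite [(X2 w - x)%R]addrC addrA addrK.
    by rewrite [X in (_ <= _ * X)%R]mulrC ler_divM_cancel// mulr_ge0.
rewrite (@tonelli_lebesgue _ _ _ P K)//.
rewrite -(integral_density1 drho).
apply: ae_ge0_le_integral => //.
- by move=> c _; exact: integral_ge0.
- exact: measurable_fun_integral_fst.
- by move=> c _; rewrite lee_fin.
- exact/measurable_EFinP.
apply: (@filterS _ _ (ae_filter_ringOfSetsType lambda) _ _ _ rhoE) => c.
rewrite rU => rc _; rewrite PK rc -!EFinM lee_fin.
have [->|rhoc] := eqVneq (rho c) 0%R; first by rewrite mulr0 mulr0.
by rewrite mulrA mulVf// mul1r.
Qed.

Lemma diff_entropy_plus_le_of_density : entropy_finite f -> entropy_finite p ->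
  entropy_finite m ->
  (diff_entropy p + diff_entropy f <= diff_entropy m + diff_entropy m)%R.
Proof.
move=> ff fp fm.
have mC : measurable_fun setT (fun z => U z + (V z - W z))%R by measurability.
apply: (@diff_entropy_le _ _ _ M _ _ _ _ (fun z => Za z + Zb z)%R _ _ _ _ 2
  _ _ _ _ dUW_diff dVW_diff dUV_sum dW fm fm fp ff).
- exact: measurable_funB.
- exact: measurable_funB.
- exact: measurable_funD.
- exact: mW.
- exact: measurable_funD.
- by move=> z; rewrite addr_ge0.
- under eq_integral do rewrite EFinD.
  rewrite ge0_integralD//; last 4 first.
    by move=> z _; rewrite lee_fin.
    exact/measurable_EFinP.
    by move=> z _; rewrite lee_fin.
    exact/measurable_EFinP.
  by rewrite (_ : 2%:E = 1 + 1)// leeD.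
(* [rho] is not one of the four densities compared, so its positivity is obtained separately; it is
   needed to cancel [rho] in [Za * Zb]. *)
have rho_gt0 := ae_density_gt0 mC drho.
apply: (@filterS _ _ (ae_filter_ringOfSetsType M) _ _ _ rho_gt0) => z rz a1 a2 b1 b2.
have a0 : (0 < Za z)%R by rewrite /Za divr_gt0// mulr_gt0.
have b0 : (0 < Zb z)%R by rewrite /Zb divr_gt0.
rewrite (_ : _ / _ = Za z * Zb z)%R; last first.
  rewrite /Za /Zb !invfM -[RHS]mulrA [X in _ = (_ * X)%R]mulrACA.
  by rewrite mulVf ?gt_eqF// mul1r [X in _ = (_ * X)%R]mulrC.
rewrite lnM ?posrE//; apply: (le_trans (lerD (ln_le_subr1 a0) (ln_le_subr1 b0))).
by rewrite addrACA -opprD.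
Qed.

End triple_sum.

(** Supplies [rho] as the convolution density of [U] and the independent [V - W]. *)
Lemma diff_entropy_plus_le : entropy_finite f -> entropy_finite p ->
  entropy_finite m ->
  (diff_entropy p + diff_entropy f <= diff_entropy m + diff_entropy m)%R.
Proof.
have UD : indep2 M U (fun z => V z - W z)%R.
  exact: (indep2_fst_comp P (phi := fun z => z.1 - z.2)%R mX1 mX2 mX2 mdiff X12).
have [rho drho rhoE] := is_density_add mU (measurable_funB mV mW) UD dVW_diff.
exact: (diff_entropy_plus_le_of_density drho rhoE).
Qed.

End sum_difference.

Unset Implicit Arguments.

Theorem mainTheorem5 (d : measure_display) (T : measurableType d) (R : realType)
  (P : probability T R) (X1 X2 : T -> R) (f fplus fminus : R -> R) :
  measurable_fun setT X1 -> measurable_fun setT X2 ->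
  indep2 P X1 X2 -> ident_distr P X1 X2 ->
  is_density P X1 f ->
  is_density P (fun w => X1 w + X2 w) fplus ->
  is_density P (fun w => X1 w - X2 w) fminus ->
  entropy_finite f -> entropy_finite fplus -> entropy_finite fminus ->
  diff_entropy fplus - diff_entropy f <= 2 * (diff_entropy fminus - diff_entropy f) /\
  diff_entropy fminus - diff_entropy f <= 2 * (diff_entropy fplus - diff_entropy f).
Proof.
move=> mX1 mX2 X12 X12_id dX1 dp dm ff fp fm.
have dX2 : is_density P X2 f.
  have [mf [f0 PX1]] := dX1.
  by split; [exact: mf|split => // A mA]; rewrite -X12_id// PX1.
have hp := diff_entropy_plus_le mX1 mX2 X12 dX1 dX2 dp dm ff fp fm.
have hm := diff_entropy_minus_le mX1 mX2 X12 dX1 dX2 dp dm ff fp fm.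
(* Both entropy bounds have the shape [a + b <= c + c], with [b] the entropy of [X1]. *)
have dbl (a b c : R) : a + b <= c + c -> a - b <= 2 * (c - b).
  by rewrite mulrBr !mulr_natl !mulr2n opprD addrA lerD2r lerBrDr.
by split; exact: dbl.
Qed.
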